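(* For each positive integer $n$ write the harmonic number $H_n=1+\frac12+\cdots+\frac1n$ in lowest terms as $H_n=c_n/d_n$ with $c_n,d_n$ positive integers and $\gcd(c_n,d_n)=1$. Then each of the following holds for infinitely many $n$: (i) $d_n>d_{n-1}$; (ii) $d_n=d_{n-1}$; (iii) $d_n<d_{n-1}$; (iv) $c_n>c_{n-1}$; (v) $c_n<c_{n-1}$. Moreover, $c_n\neq c_{n-1}$ for all $n>1$.
   Context: $c_n$ and $d_n$ denote the numerator and denominator of the reduced fraction for $H_n=\sum_{k=1}^n 1/k$. *)

(* Defs.v *)
From mathcomp Require Import all_boot all_order all_algebra.

Set Implicit Arguments.
Unset Strict Implicit.
Unset Printing Implicit Defensive.

Import GRing.Theory.
Local Open Scope ring_scope.

Definition harmonic_number (n : nat) : rat := \sum_(1 <= k < n.+1) k%:R^-1.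

(* numq and denq return the reduced fraction, with a positive denominator. *)
Definition harmonic_num (n : nat) : int := numq (harmonic_number n).
Definition harmonic_den (n : nat) : int := denq (harmonic_number n).

(* Main.v *)
(** The sum of the 1/k over k <= n with p | k is H_{n/p} / p (integer part of
    n/p), so H_n is congruent to H_{n/p} / p modulo p-integral rationals.
    - n = p prime: H_{p-1} is p-integral, so d_p = p d_{p-1}, and c_p > c_{p-1}.
    - n = 2p, p > 3: modulo p-integral rationals H_{2p} is 3/(2p) and H_{2p-1}
      is 1/p, and no H_m with m > 1 is 2-integral; so 2p divides both d_{2p-1}
      and d_{2p}, which are therefore equal.
    - n = p (p - 1), p odd: H_n is p-integral because p divides the numerator
      of H_{p-1}, whereas H_{n-1} is not. The loss of the factor p outweighs the
      possible gain of a divisor of p - 1: d_n <= d_{n-1} (p - 1) / p. As H_n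
      exceeds H_{n-1} by a factor at most 1 + 1/n, also c_n < c_{n-1}.
    - If c_n = c_{n-1} = c, then H_n - H_{n-1} = 1/n shows that c divides
      d_n d_{n-1}; being prime to both, c = 1, which contradicts H_n > 1. *)
Require Import Defs.
From mathcomp Require Import all_boot all_order all_algebra ring lra zify.
From mathcomp Require Import classical_sets cardinality.

Set Implicit Arguments.
Unset Strict Implicit.
Unset Printing Implicit Defensive.

Import Order.TTheory GRing.Theory Num.Theory.
Local Open Scope classical_set_scope.
Local Open Scope ring_scope.

(** * Denominators and [p]-integral rationals *)

Lemma denq_dvd_int (x : rat) (b : int) : (denq x %| b)%Z = (x * b%:~R \is a Num.int).
Proof.
apply/dvdzP/idP => [[c ->]|/intrP [m xb]].
  by rewrite intrM mulrCA -numqE -intrM.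
have : (denq x %| numq x * b)%Z.
  apply/dvdzP; exists m; apply: (@intr_inj rat).
  by rewrite !intrM numqE -xb mulrAC.
rewrite Gauss_dvdzr; first by case/dvdzP => c ->; exists c.
by rewrite coprimezE coprime_sym coprime_num_den.
Qed.

Lemma denq_le_dvd (x : rat) (b : int) : 0 < b -> (denq x %| b)%Z -> denq x <= b.
Proof.
move=> b0; rewrite dvdzE => /dvdn_leq; rewrite absz_gt0 gt_eqF // => /(_ isT).
by have := denq_gt0 x; lia.
Qed.

(** For prime [p] this is membership in the localization of the integers at [p]. *)
Definition p_integral (p : nat) (x : rat) : bool := ~~ (Posz p %| denq x)%Z.

Section PIntegral.
Variables (p : nat) (p_pr : prime p).

(** Lets integrality be read off any common denominator, reduced or not. *)
Lemma p_integral_denq_dvd (x : rat) (b : int) :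
  (denq x %| b)%Z -> ~~ (Posz p %| b)%Z -> p_integral p x.
Proof. by move=> db; apply: contraNN => /dvdz_trans; apply. Qed.

Lemma prime_ndvd_mul_denq (x y : rat) :
  p_integral p x -> p_integral p y -> ~~ (Posz p %| denq x * denq y)%Z.
Proof.
move=> xp yp; rewrite dvdzE abszM Euclid_dvdM // negb_or.
by rewrite -!dvdzE; apply/andP.
Qed.

Lemma p_integralD (x y : rat) : p_integral p x -> p_integral p y -> p_integral p (x + y).
Proof.
move=> xp yp; apply: p_integral_denq_dvd (prime_ndvd_mul_denq xp yp).
rewrite denq_dvd_int intrM mulrDl mulrA -numqE [y * _]mulrCA -numqE.
by rewrite -!intrM -intrD intr_int.
Qed.

Lemma p_integralN (x : rat) : p_integral p (- x) = p_integral p x.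
Proof. by rewrite /p_integral denqN. Qed.

Lemma p_integralB (x y : rat) : p_integral p x -> p_integral p y -> p_integral p (x - y).
Proof. by move=> xp yp; rewrite p_integralD ?p_integralN. Qed.

Lemma p_integralM (x y : rat) : p_integral p x -> p_integral p y -> p_integral p (x * y).
Proof.
move=> xp yp; apply: p_integral_denq_dvd (prime_ndvd_mul_denq xp yp).
by rewrite denq_dvd_int intrM mulrACA -!numqE -intrM intr_int.
Qed.

Lemma p_integral_nat (k : nat) : p_integral p k%:R.
Proof.
rewrite /p_integral (denq_int k) dvdzE /= dvdn1.
by apply: contraTneq p_pr => ->.
Qed.

Lemma p_integral_sum (m n : nat) (F : nat -> rat) :
  (forall k, (m <= k < n)%N -> p_integral p (F k)) ->
  p_integral p (\sum_(m <= k < n) F k).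
Proof.
move=> Fp; rewrite big_nat; apply: (big_ind (p_integral p)) => [|x y|k /Fp //].
  exact: (p_integral_nat 0).
exact: p_integralD.
Qed.

Lemma p_integral_invn (k : nat) : ~~ (p %| k)%N -> p_integral p k%:R^-1.
Proof.
case: k => [|k]; first by rewrite dvdn0.
move=> pk; apply: (@p_integral_denq_dvd _ (Posz k.+1)) => //.
by rewrite denq_dvd_int mulVf ?int_num1 ?pnatr_eq0.
Qed.

Lemma p_integral_divp (k : nat) : ~~ (p %| k)%N -> ~~ p_integral p (k%:R / p%:R).
Proof.
move=> pk; rewrite negbK.
have := @coprimeq_den (Posz k) (Posz p).
rewrite /= coprime_sym prime_coprime // pk => -> //.
(* [coprimeq_den] treats a zero divisor separately; [p > 0] excludes that case. *)
by have := prime_gt0 p_pr; rewrite lt0n => /negPf; rewrite eqz_nat => ->.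
Qed.

Lemma p_integral_invp : ~~ p_integral p p%:R^-1.
Proof.
have := @p_integral_divp 1; rewrite mul1r; apply.
by rewrite dvdn1; apply: contraTneq p_pr => ->.
Qed.

Lemma p_integral_congr (x y : rat) :
  p_integral p (x - y) -> p_integral p x = p_integral p y.
Proof.
move=> xy; apply/idP/idP => [xp|yp]; last by rewrite -(subrK y x) p_integralD.
by rewrite -(subKr x y) p_integralB.
Qed.

End PIntegral.

(** * Harmonic numbers modulo [p]-integral rationals *)

Local Notation H := harmonic_number.

Lemma harmonicS (n : nat) : H n.+1 = H n + n.+1%:R^-1.
Proof. by rewrite /H big_nat_recr. Qed.

Lemma harmonic0 : H 0 = 0.
Proof. by rewrite /H big_geq. Qed.

Lemma harmonic1 : H 1 = 1.
Proof. by rewrite harmonicS harmonic0 add0r invr1. Qed.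

Lemma harmonic_ge1 (n : nat) : (0 < n)%N -> 1 <= H n.
Proof.
elim: n => // -[_|n IH] _; first by rewrite harmonic1.
by rewrite harmonicS; apply: (le_trans (IH isT)); rewrite lerDl invr_ge0.
Qed.

Lemma harmonic_gt1 (n : nat) : (1 < n)%N -> 1 < H n.
Proof.
case: n => // -[|n] // _; rewrite harmonicS.
by rewrite (le_lt_trans (harmonic_ge1 (ltn0Sn n))) // ltrDl invr_gt0.
Qed.

Lemma harmonic_p_integral (p n : nat) : prime p -> (n < p)%N -> p_integral p (H n).
Proof.
move=> p_pr np; apply: p_integral_sum => // k /andP[k0 kn].
by apply: p_integral_invn; rewrite // gtnNdvd // (leq_trans kn).
Qed.

(** Induction on [n]: if [p] does not divide [n.+1], the quotient stays the same and the new term is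
    [p]-integral. Otherwise the quotient grows by one, and its new term divided by [p] cancels
    1/(n+1) exactly. *)
Lemma harmonic_div_p_integral (p n : nat) : prime p ->
  p_integral p (H n - H (n %/ p) / p%:R).
Proof.
move=> p_pr; elim: n => [|n IH].
  by rewrite div0n harmonic0 mul0r subr0; apply: (p_integral_nat p_pr 0).
rewrite (divnS n (prime_gt0 p_pr)) harmonicS.
case: (boolP (p %| n.+1)%N) => [|pn]; last first.
  by rewrite add0n addrAC; apply: p_integralD => //; apply: p_integral_invn.
rewrite add1n harmonicS => pn; have := divnS n (prime_gt0 p_pr).
rewrite pn add1n => <-.
have -> : n.+1%:R^-1 = (n.+1 %/ p)%:R^-1 / p%:R :> rat.
  by rewrite -invfM -natrM divnK.
by rewrite mulrDl opprD addrACA subrr addr0.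
Qed.

(* Pair the terms k and p - k. *)
Lemma wolstenholme_mod_p (p : nat) : prime p -> odd p ->
  p_integral p (H p.-1 / p%:R).
Proof.
move=> p_pr p_odd; have p0 := prime_gt0 p_pr.
have p_neq0 : p%:R != 0 :> rat by rewrite pnatr_eq0 -lt0n.
(* Summing 1/k + 1/(p-k) = p/(k(p-k)) over all k counts each pair twice; the resulting factor 1/2 is
   [p]-integral because [p] is odd. *)
have E : H p.-1 / p%:R
    = 2%:R^-1 * \sum_(1 <= k < p) (k%:R^-1 * (p - k)%:R^-1).
  have : H p.-1 + H p.-1
      = p%:R * \sum_(1 <= k < p) (k%:R^-1 * (p - k)%:R^-1).
    rewrite {2}/harmonic_number big_nat_rev /harmonic_number prednK //.
    rewrite -big_split mulr_sumr /=; apply: eq_big_nat => k /andP[k0 kp].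
    have -> : (1 + p - k.+1 = p - k)%N by lia.
    rewrite natrB 1?ltnW //; field.
    by rewrite -natrB 1?ltnW // !pnatr_eq0; lia.
  have -> : H p.-1 / p%:R = 2%:R^-1 * (H p.-1 + H p.-1) / p%:R by field.
  by move=> ->; field.
rewrite E; apply: p_integralM => //.
  by apply: p_integral_invn => //; rewrite gtnNdvd // odd_prime_gt2.
apply: p_integral_sum => // k /andP[k0 kp].
by apply: p_integralM => //; apply: p_integral_invn; rewrite // gtnNdvd //; lia.
Qed.

(** Descent by halving: if [H n / 2] were 2-integral, so would be [H n], and hence the congruent
    [H (n %/ 2) / 2]. The descent ends at [n = 1] with 1/2. *)
Lemma half_harmonic_not_2_integral (n : nat) : (0 < n)%N ->
  ~~ p_integral 2 (H n / 2%:R).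
Proof.
have two : prime 2 by [].
elim/ltn_ind: n => n IH n0; case: (ltnP 1 n) => [n1|n1]; last first.
  have -> : n = 1%N by lia.
  by rewrite harmonic1 mul1r p_integral_invp.
apply: contraNN (IH (n %/ 2)%N ltac:(lia) ltac:(lia)) => Hn.
rewrite -(p_integral_congr two (harmonic_div_p_integral n two)).
have -> : H n = 2%:R * (H n / 2%:R) by field.
by apply: p_integralM => //; apply: p_integral_nat.
Qed.

Lemma harmonic_not_2_integral (n : nat) : (1 < n)%N -> ~~ p_integral 2 (H n).
Proof.
have two : prime 2 by [].
move=> n1; rewrite (p_integral_congr two (harmonic_div_p_integral n two)).
by apply: half_harmonic_not_2_integral; lia.
Qed.

(** * Comparison of consecutive denominators and numerators *)

Lemma harmonic_den_gt0 (n : nat) : 0 < harmonic_den n.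
Proof. exact: denq_gt0. Qed.

Lemma harmonic_numE (n : nat) : (harmonic_num n)%:~R = H n * (harmonic_den n)%:~R.
Proof. exact: numqE. Qed.

Lemma harmonic_num_lt (n : nat) : (0 < n)%N ->
  harmonic_den n.-1 <= harmonic_den n -> harmonic_num n.-1 < harmonic_num n.
Proof.
case: n => // n _ /= d_le; rewrite -(ltr_int rat) !harmonic_numE harmonicS mulrDl.
apply: ltr_pwDr; first by rewrite mulr_gt0 ?invr_gt0 ?ltr0z ?harmonic_den_gt0.
by rewrite ler_wpM2l ?ler_int //; case: n {d_le} => [|n];
  rewrite ?harmonic0 // (le_trans ler01) ?harmonic_ge1.
Qed.

Lemma harmonic_den_prime (p : nat) : prime p -> harmonic_den p.-1 < harmonic_den p.
Proof.
move=> p_pr; have p0 := prime_gt0 p_pr.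
have Hp1 : p_integral p (H p.-1) by rewrite harmonic_p_integral ?ltn_predL.
have HpE : H p = H p.-1 + p%:R^-1 by rewrite -{1 3}(prednK p0) harmonicS.
have Hp : (Posz p %| denq (H p))%Z.
  rewrite -[X in is_true X]negbK -/(p_integral p (H p)).
  apply: contra (p_integral_invp p_pr) => Hp.
  have -> : p%:R^-1 = H p - H p.-1 by rewrite HpE addrC addKr.
  exact: p_integralB.
(* Being a multiple of [p], the denominator of [H p] clears 1/p too, hence also the difference
   [H p.-1]. *)
have dd : (denq (H p.-1) %| denq (H p))%Z.
  rewrite denq_dvd_int; have -> : H p.-1 = H p - p%:R^-1 by rewrite HpE addrK.
  rewrite mulrBl -numqE; case/dvdzP: Hp => c ->.
  by rewrite intrM mulrCA mulVf ?mulr1 -?intrB ?intr_int // pnatr_eq0 -lt0n.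
rewrite /harmonic_den lt_neqAle; apply/andP; split.
  by apply/eqP => E; move: Hp1; rewrite /p_integral E Hp.
by rewrite denq_le_dvd ?denq_gt0.
Qed.

(* If n divides both denominators, adding or removing 1/n changes neither. *)
Lemma harmonic_den_eq (n : nat) : (0 < n)%N ->
  (Posz n %| harmonic_den n.-1)%Z -> (Posz n %| harmonic_den n)%Z ->
  harmonic_den n = harmonic_den n.-1.
Proof.
case: n => // n _ /=; rewrite /harmonic_den => n_dvd nS_dvd.
have nS_neq0 : n.+1%:R != 0 :> rat by rewrite pnatr_eq0.
have : (denq (H n) %| denq (H n.+1))%Z.
  rewrite denq_dvd_int -[H n](addrK n.+1%:R^-1) -harmonicS mulrBl -numqE.
  by case/dvdzP: nS_dvd => c ->; rewrite intrM mulrCA mulVf // mulr1 -intrB intr_int.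
have : (denq (H n.+1) %| denq (H n))%Z.
  rewrite denq_dvd_int harmonicS mulrDl -numqE.
  by case/dvdzP: n_dvd => c ->; rewrite intrM mulrCA mulVf // mulr1 -intrD intr_int.
by move=> d1 d2; apply/le_anti; rewrite !denq_le_dvd ?denq_gt0.
Qed.

Lemma harmonic_den_double_prime (p : nat) : prime p -> (3 < p)%N ->
  harmonic_den (2 * p) = harmonic_den (2 * p).-1.
Proof.
move=> p_pr p3; have p0 := prime_gt0 p_pr.
have dvd n : (1 < n)%N -> ~~ p_integral p (H n) ->
    (Posz (2 * p) %| harmonic_den n)%Z.
  move=> n1 /negPn; rewrite /harmonic_den !dvdzE /= => pd.
  have := harmonic_not_2_integral n1; rewrite negbK dvdzE /= => d2.
  by rewrite Gauss_dvd ?d2 // coprime2n; case: (even_prime p_pr) => // p2; lia.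
apply: harmonic_den_eq; first lia; apply: dvd; try lia;
  rewrite (p_integral_congr p_pr (harmonic_div_p_integral _ p_pr)).
- have -> : ((2 * p).-1 %/ p = 1)%N.
    by have -> : ((2 * p).-1 = 1 * p + p.-1)%N by [lia]; rewrite divnMDl // divn_small ?ltn_predL.
  by rewrite harmonic1 mul1r p_integral_invp.
- rewrite mulnK // harmonicS harmonic1.
  (* Twice 3/(2p) is 3/p, which is not [p]-integral because [p > 3]. *)
  apply: contra (p_integral_divp p_pr (k := 3) _) => [Hp|]; last by rewrite gtnNdvd.
  have -> : 3%:R / p%:R = 2%:R * ((1 + 2%:R^-1) / p%:R) :> rat.
    by field; rewrite pnatr_eq0 -lt0n.
  by apply: p_integralM => //; apply: p_integral_nat.
Qed.

Section PrimeTimesPred.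
Variables (p : nat) (p_pr : prime p) (p2 : (2 < p)%N).
Let n := (p * p.-1)%N.

(* Only p.-1 survives of n in lcm (d_{n-1}, n), because the factor p cancels. *)
Lemma harmonic_den_mul_pred : harmonic_den n * p%:R <= harmonic_den n.-1 * p.-1%:R.
Proof.
have p0 := prime_gt0 p_pr.
have n0 : (0 < n)%N by rewrite /n; lia.
have HnE : H n = H n.-1 + n%:R^-1 by rewrite -{1 3}(prednK n0) harmonicS.
have p_neq0 : p%:R != 0 :> rat by rewrite pnatr_eq0 -lt0n.
have p1_neq0 : p.-1%:R != 0 :> rat by rewrite pnatr_eq0; lia.
have Hn : p_integral p (H n).
  rewrite (p_integral_congr p_pr (harmonic_div_p_integral _ p_pr)) mulKn //.
  by apply: wolstenholme_mod_p => //; case: (even_prime p_pr) => // ?; lia.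
(* Were [H n.-1] also [p]-integral, so would be (p-1)(H_n - H_{n-1}) = 1/p. *)
have Hn1 : (Posz p %| harmonic_den n.-1)%Z.
  rewrite -[X in is_true X]negbK -/(p_integral p (H n.-1)).
  apply: contra (p_integral_invp p_pr) => Hn1.
  have -> : p%:R^-1 = p.-1%:R * (H n - H n.-1).
    by rewrite HnE /n natrM; field; apply/andP.
  by apply: p_integralM => //; [apply: p_integral_nat|apply: p_integralB].
case/dvdzP: Hn1 => d dE.
have d0 : 0 < d by have := harmonic_den_gt0 n.-1; rewrite dE pmulr_lgt0.
have : (denq (H n) %| Posz p * (d * Posz p.-1))%Z.
  rewrite denq_dvd_int HnE mulrDl.
  have -> : H n.-1 * (Posz p * (d * Posz p.-1))%:~R = (harmonic_num n.-1 * p.-1%:R)%:~R.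
    by rewrite !intrM harmonic_numE dE intrM; ring.
  have -> : n%:R^-1 * (Posz p * (d * Posz p.-1))%:~R = d%:~R :> rat.
    by rewrite /n natrM !intrM; field; apply/andP.
  by rewrite -intrD intr_int.
rewrite Gauss_dvdzr; last first.
  by rewrite coprimezE coprime_sym prime_coprime // -dvdzE.
move=> dvd; have : denq (H n) <= d * Posz p.-1.
  by apply: denq_le_dvd => //; rewrite mulr_gt0 //; lia.
rewrite dE /harmonic_den => le_d.
by rewrite !natz [leRHS]mulrAC ler_pM2r.
Qed.

Lemma harmonic_den_mul_pred_lt : harmonic_den n < harmonic_den n.-1.
Proof.
have := harmonic_den_mul_pred; have := harmonic_den_gt0 n.-1.
have -> : p%:R = p.-1%:R + 1 :> int by rewrite -[in LHS](prednK (prime_gt0 p_pr)) -natr1.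
have : 0 < p.-1%:R :> int by rewrite ltr0n; lia.
nia.
Qed.

Lemma harmonic_num_mul_pred_lt : harmonic_num n < harmonic_num n.-1.
Proof.
have p0 := prime_gt0 p_pr.
have n1 : (1 < n)%N by rewrite /n; nia.
have HnE : H n = H n.-1 + n%:R^-1.
  by rewrite -{1 3}(prednK (ltnW n1)) harmonicS.
have pr0 : 0 < p%:R :> rat by rewrite ltr0n.
have qr0 : 0 < p.-1%:R :> rat by rewrite ltr0n; lia.
have pE : p%:R = p.-1%:R + 1 :> rat by rewrite -[in LHS](prednK p0) -natr1.
rewrite -(ltr_int rat) !harmonic_numE -(ltr_pM2r pr0) -[ltLHS]mulrA.
have le_d : (harmonic_den n)%:~R * p%:R <= (harmonic_den n.-1)%:~R * p.-1%:R :> rat.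
  by have := harmonic_den_mul_pred; rewrite -(ler_int rat) !intrM !natz.
have H1 : 1 <= H n.-1 by apply: harmonic_ge1; lia.
have H0 : 0 <= H n by rewrite (le_trans ler01) // harmonic_ge1 // ltnW.
apply: (le_lt_trans (ler_wpM2l H0 le_d)).
have d0 : 0 < (harmonic_den n.-1)%:~R :> rat by rewrite ltr0z harmonic_den_gt0.
(* Once d_{n-1} is cancelled, H_n (p-1) < H_{n-1} p remains; since n = p(p-1), this amounts to 1/p <
   H_{n-1}. *)
rewrite -[ltRHS]mulrA [ltLHS]mulrCA [ltRHS]mulrCA ltr_pM2l // HnE mulrDl /n natrM invfM.
rewrite mulrVK ?unitfE ?gt_eqF // pE.
have : (p.-1%:R + 1)^-1 < 1 :> rat by rewrite invf_lt1 ?ltrDr // addr_gt0.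
lra.
Qed.

End PrimeTimesPred.

Lemma harmonic_num_neq (n : nat) : (1 < n)%N -> harmonic_num n <> harmonic_num n.-1.
Proof.
case: n => // n n1 /= E.
have HS := harmonic_gt1 n1.
pose c := harmonic_num n.+1.
have c0 : 0 < c.
  by rewrite -(ltr_int rat) harmonic_numE mulr_gt0 ?ltr0z ?harmonic_den_gt0 // (lt_trans ltr01).
have dvd : (c %| harmonic_den n * harmonic_den n.+1)%Z.
  (* The cofactor comes from clearing denominators in c/d_{n+1} - c/d_n = 1/(n+1). *)
  apply/dvdzP; exists (n.+1%:R * (harmonic_den n - harmonic_den n.+1)).
  apply: (@intr_inj rat); rewrite !intrM intrB.
  have := harmonic_numE n.+1; have := harmonic_numE n; rewrite -E -/c.
  rewrite harmonicS => e1 e2.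
  have nz : n.+1%:R != 0 :> rat by rewrite pnatr_eq0.
  have -> : (n.+1%:R%:~R : rat) = n.+1%:R by rewrite natz.
  have -> : n.+1%:R * ((harmonic_den n)%:~R - (harmonic_den n.+1)%:~R) * c%:~R
    = n.+1%:R * ((harmonic_den n)%:~R * c%:~R - (harmonic_den n.+1)%:~R * c%:~R) :> rat by ring.
  by rewrite {1}e2 e1; field; rewrite addrC natr1.
have cop m : harmonic_num m = c -> coprimez c (harmonic_den m).
  by move=> <-; exact: coprime_num_den.
(* Coprimality with d_n leaves c dividing d_{n+1}, so their gcd, which is 1, equals c. *)
rewrite Gauss_dvdzr ?cop // in dvd.
have := cop _ (erefl c); rewrite coprimezE /coprime.
move: dvd; rewrite dvdzE => /gcdn_idPl -> /eqP c1.
have {}c1 : c = 1 by lia.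
have := harmonic_numE n.+1; rewrite -/c c1 => e.
have : 1 < H n.+1 * (harmonic_den n.+1)%:~R.
  rewrite (lt_le_trans HS) // ler_peMr ?(ltW (lt_trans ltr01 HS)) //.
  by rewrite ler1z; have := harmonic_den_gt0 n.+1; lia.
by rewrite -e ltxx.
Qed.

(** * From unbounded families of indices to infinite sets *)

Lemma infinite_unbounded (A : set nat) :
  (forall m, exists2 n, (m <= n)%N & A n) -> infinite_set A.
Proof.
move=> unb /finite_seqP [s As]; case: (unb (\max_(i <- s) i).+1) => n lt_n.
by rewrite As /= => ns; have := leq_bigmax_seq (F := id) n ns isT; rewrite leqNgt lt_n.
Qed.

Theorem theorem1 :
  infinite_set [set n : nat | (1 < n)%N /\ harmonic_den n > harmonic_den n.-1] /\
  infinite_set [set n : nat | (1 < n)%N /\ harmonic_den n = harmonic_den n.-1] /\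
  infinite_set [set n : nat | (1 < n)%N /\ harmonic_den n < harmonic_den n.-1] /\
  infinite_set [set n : nat | (1 < n)%N /\ harmonic_num n > harmonic_num n.-1] /\
  infinite_set [set n : nat | (1 < n)%N /\ harmonic_num n < harmonic_num n.-1] /\
  (forall n : nat, (1 < n)%N -> harmonic_num n <> harmonic_num n.-1).
Proof.
(* One such prime serves all five families, as p, 2p and p(p-1) are all at least [m]. *)
have big_prime m : exists p, [/\ prime p, (3 < p)%N & (m <= p)%N].
  by case: (prime_above (maxn 3 m)) => p mp p_pr; exists p; split=> //; lia.
split; [|split; [|split; [|split; [|split]]]]; last exact: harmonic_num_neq;
  apply: infinite_unbounded => m; have [p [p_pr p3 mp]] := big_prime m.
- by exists p => //; split; [lia|exact: harmonic_den_prime].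
- by exists (2 * p)%N; [lia|split; [lia|exact: harmonic_den_double_prime]].
- by exists (p * p.-1)%N; [nia|split; [nia|apply: harmonic_den_mul_pred_lt; lia]].
- exists p => //; split; first lia.
  by apply: harmonic_num_lt; [lia|exact/ltW/harmonic_den_prime].
- by exists (p * p.-1)%N; [nia|split; [nia|apply: harmonic_num_mul_pred_lt; lia]].
Qed.
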